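(* If $t$ is the square of a positive integer, then a very general quasimonomial valuation $v(\xi,t)$ is minimal, i.e. $\hat\mu(\xi,t)=\sqrt t$ for very general $\xi\in\mathbb{C}[[x]]$ with $\xi(0)=0$.
   Context: We work over $\mathbb{C}$. For $\xi\in\mathbb{C}[[x]]$ with $\xi(0)=0$ and real $t\ge 1$, the quasimonomial valuation $v(\xi,t)$ of $\mathbb{C}(x,y)$ is given on polynomials by $f\mapsto v(\xi,t;f)=\operatorname{ord}_x f(x,\xi(x)+\theta x^t)$, $\theta$ transcendental over $\mathbb{C}$; equivalently, if $f=\sum a_{ij}x^i(y-\xi(x))^j$, then $v(\xi,t;f)=\min\{i+tj\mid a_{ij}\ne0\}$. Put $\mu_d(\xi,t)=\max\{v(\xi,t;f)\mid 0\ne f\in\mathbb{C}[x,y],\ \deg f\le d\}$ and $\hat\mu(\xi,t)=\lim_{d\to\infty}\mu_d(\xi,t)/d$. A valuation $v$ of $\mathbb{P}^2$ centered at the origin is called minimal if $\hat\mu(v)=1/\sqrt{\operatorname{vol}(v)}$; since $\operatorname{vol}(v(\xi,t))=1/t$, $v(\xi,t)$ is minimal exactly when $\hat\mu(\xi,t)=\sqrt t$. ''Very general'' means that the coefficients of (a jet of) $\xi$ lie outside a countable union of proper Zariski closed subsets. *)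

(* Defs.v *)
From HB Require Import structures.
From mathcomp Require Import all_boot all_order all_algebra.
From mathcomp Require Import complex mpoly.
From mathcomp Require Import boolp classical_sets reals ereal topology.
From mathcomp Require Import normedtype sequences.

Set Implicit Arguments.
Unset Strict Implicit.
Unset Printing Implicit Defensive.

Import Order.TTheory GRing.Theory Num.Theory.
Import numFieldNormedType.Exports.

Local Open Scope classical_set_scope.
Local Open Scope ring_scope.

(** Formal power series in one variable. A record, and not an alias of
    [nat -> K], because functions already carry the pointwise product. *)

Record fps (K : Type) := Fps { fcoef : nat -> K }.

HB.instance Definition _ (K : Type) := [isNew for @fcoef K].
HB.instance Definition _ (K : Type) := gen_eqMixin (fps K).
HB.instance Definition _ (K : Type) := gen_choiceMixin (fps K).

Lemma fpsP (K : Type) (a b : fps K) : fcoef a =1 fcoef b <-> a = b.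
Proof. by split=> [|-> //]; case: a b => a [b] /= /funext ->. Qed.

Section FpsZmodule.
Variable K : zmodType.
Implicit Types a b c : fps K.

Definition fps0 : fps K := Fps (fun _ => 0).
Definition fps_opp a : fps K := Fps (fun n => - fcoef a n).
Definition fps_add a b : fps K := Fps (fun n => fcoef a n + fcoef b n).

Fact fps_addA : associative fps_add.
Proof. by move=> a b c; apply/fpsP => n /=; rewrite addrA. Qed.
Fact fps_addC : commutative fps_add.
Proof. by move=> a b; apply/fpsP => n /=; rewrite addrC. Qed.
Fact fps_add0 : left_id fps0 fps_add.
Proof. by move=> a; apply/fpsP => n /=; rewrite add0r. Qed.
Fact fps_addN : left_inverse fps0 fps_opp fps_add.
Proof. by move=> a; apply/fpsP => n /=; rewrite addNr. Qed.

HB.instance Definition _ :=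
  GRing.isZmodule.Build (fps K) fps_addA fps_addC fps_add0 fps_addN.

End FpsZmodule.

Section FpsRing.
Variable K : comNzRingType.
Implicit Types a b c : fps K.

Definition fpsC (k : K) : fps K := Fps (fun n => if n == 0%N then k else 0).
Definition fpsX : fps K := Fps (fun n => (n == 1%N)%:R).

Definition fps_mul a b : fps K :=
  Fps (fun n => \sum_(i < n.+1) fcoef a i * fcoef b (n - i)%N).

Definition fps_trunc (n : nat) a : {poly K} := \poly_(i < n.+1) fcoef a i.

Lemma coef_fps_trunc n a i : (i <= n)%N -> (fps_trunc n a)`_i = fcoef a i.
Proof. by move=> le_in; rewrite coef_poly ltnS le_in. Qed.

Lemma fps_mul_trunc n a b i : (i <= n)%N ->
  fcoef (fps_mul a b) i = (fps_trunc n a * fps_trunc n b)`_i.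
Proof.
move=> le_in; rewrite coefM /=; apply: eq_bigr => j _.
rewrite !coef_fps_trunc //; last by rewrite (leq_trans _ le_in) // -ltnS.
by rewrite (leq_trans _ le_in) // leq_subr.
Qed.

Fact fps_mulC : commutative fps_mul.
Proof.
by move=> a b; apply/fpsP => n; rewrite !(@fps_mul_trunc n) // mulrC.
Qed.

Fact fps_mulA : associative fps_mul.
Proof.
move=> a b c; apply/fpsP => n.
transitivity ((fps_trunc n a * fps_trunc n b * fps_trunc n c)`_n).
  rewrite -mulrA coefM /=; apply: eq_bigr => i _.
  by rewrite coef_fps_trunc -1?ltnS // -(@fps_mul_trunc n) // leq_subr.
rewrite coefM /=; apply: eq_bigr => i _.
by rewrite -(@fps_mul_trunc n) -1?ltnS // coef_fps_trunc // leq_subr.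
Qed.

Fact fps_mul1 : left_id (fpsC 1) fps_mul.
Proof.
move=> a; apply/fpsP => n /=; rewrite big_ord_recl /= mul1r subn0.
by rewrite big1 ?addr0 // => i _; rewrite mul0r.
Qed.

Fact fps_mulDl : left_distributive fps_mul (@fps_add K).
Proof.
move=> a b c; apply/fpsP => n /=.
by rewrite -big_split /=; apply: eq_bigr => i _; rewrite mulrDl.
Qed.

Fact fps_one_neq0 : fpsC 1 != 0.
Proof. by apply/eqP => /fpsP /(_ 0%N) /= /eqP; rewrite oner_eq0. Qed.

HB.instance Definition _ := GRing.Zmodule_isComNzRing.Build (fps K)
  fps_mulA fps_mulC fps_mul1 fps_mulDl fps_one_neq0.

End FpsRing.

Section Valuation.
Variable R : realType.
Local Notation C := R[i].
Implicit Types (xi : fps C) (t : R) (f : {mpoly C[2]}).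

(** Variable 0 of [{mpoly C[2]}] is x and variable 1 is y. [expansion xi f] is
    f (x, xi(x) + 'X) in C[[x]]['X]: here 'X stands for y - xi(x), and
    [fcoef (expansion xi f)`_j i] is the coefficient a_ij in
    f = sum a_ij x^i (y - xi(x))^j. *)
Definition expansion xi f : {poly fps C} :=
  mmap (fun c : C => (fpsC c)%:P)
       (fun k : 'I_2 => if k == ord0 then (fpsX C)%:P else 'X + xi%:P) f.

(** The value at 0 is +oo. *)
Definition qmval xi t f : \bar R :=
  ereal_inf [set (ij.1%:R + t * ij.2%:R)%:E
            | ij in [set ij : nat * nat |
                       fcoef (expansion xi f)`_ij.2 ij.1 != 0]].

(** [msize] is the total degree plus one. *)
Definition mu xi t (d : nat) : \bar R :=
  ereal_sup [set qmval xi t f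
            | f in [set f : {mpoly C[2]} | f != 0 /\ (msize f <= d.+1)%N]].

Definition mu_ratio xi t (d : nat) : \bar R := (mu xi t d * (d%:R^-1)%:E)%E.

Definition mu_hat xi t : \bar R := limn (mu_ratio xi t).

(** For a subspace A of V, the dimension of V / A: the supremum of the sizes of
    the families of vectors that are linearly independent modulo A. *)
Definition codim (V : lmodType C) (A : set V) : \bar R :=
  ereal_sup [set (k%:R : R)%:E
            | k in [set k : nat | exists e : 'I_k -> V,
                      forall c : 'I_k -> C,
                        A (\sum_(i < k) c i *: e i) -> forall i, c i = 0]].

Definition val_ideal xi t (m : nat) : set {mpoly C[2]} :=
  [set f | ((m%:R)%:E <= qmval xi t f)%E].

(** vol(v) = lim_m dim (O / a_m) / (m^2 / 2), where O is the local ring of P^2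
    at the origin and a_m the ideal of the elements of value at least m. As a_m
    contains a power of the maximal ideal, O / a_m is also the quotient of
    C[x, y] by its own valuation ideal. *)
Definition vol xi t : \bar R :=
  limn (fun m : nat =>
    (codim (val_ideal xi t m) * (((m%:R : R) ^+ 2 / 2%:R)^-1)%:E)%E).

Definition minimal xi t : Prop :=
  mu_hat xi t = ((Num.sqrt (fine (vol xi t)))^-1)%:E.

Definition zariski_closed (n : nat) (Z : set ('I_n -> C)) : Prop :=
  exists S : set {mpoly C[n]}, Z = [set a | forall p, S p -> p.@[a] = 0].

(** The n-jet of a series without constant term: its coefficients of
    x, ..., x^n. *)
Definition jet (n : nat) xi : 'I_n -> C := fun i => fcoef xi i.+1.

(** P holds for very general xi with xi(0) = 0. *)
Definition very_general (P : fps C -> Prop) : Prop :=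
  exists (n : nat) (Z : nat -> set ('I_n -> C)),
    (forall k, zariski_closed (Z k) /\ Z k <> setT) /\
    forall xi, fcoef xi 0%N = 0 -> ~ (\bigcup_k Z k) (jet (n:=n) xi) -> P xi.

End Valuation.

(* Main.v *)
Require Import Defs.
From HB Require Import structures.
From mathcomp Require Import all_boot all_order all_algebra.
From mathcomp Require Import complex mpoly.
From mathcomp Require Import boolp classical_sets reals ereal topology.
From mathcomp Require Import normedtype sequences.
From mathcomp Require Import zify ring.
Import Order.TTheory GRing.Theory Num.Theory.
Import numFieldNormedType.Exports.
Local Open Scope ring_scope.
Set Implicit Arguments.
Unset Strict Implicit.
Unset Printing Implicit Defensive.

(** Write t = T = n^2. As t is an integer, v(xi, t; f) is the order in x of
    f (x, x^T X + P(x)), where X is transcendental and P is the truncation of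
    xi at order T: a change of xi beyond x^T amounts to X |-> X + h(x), which
    does not change divisibility by powers of x ([qmval_geP]). So every
    condition v(f) >= m says that finitely many coefficients vanish, which are
    linear in f and polynomial in the T-jet of xi; the possibly nonzero ones
    below x^m are the x^s X^j with T j <= s < m, about m^2 / (2 T) in number.

    This count gives vol = 1 / T ([codim_val_ideal], [vol_qm]). Compared with
    the dimension of the space of polynomials of degree at most d, it also gives
    mu_d >= n (d + 1) - n^2 for every xi ([mu_ge]), so that the lower limit of
    mu_d / d is at least n.

    For the bound mu_d <= n d one specializes to xi = x^n, the branch of the
    curve y = x^n of degree n, whose equation has value T = n * n. If f of
    degree at most d does not vanish on this curve, then f (x, x^n) is a nonzero
    polynomial of degree at most n d, and v(f) is at most its order at 0;
    otherwise the equation of the curve splits off, which costs n in the degree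
    and n^2 in the value ([curve_pullback_bound]). Hence at the jet of x^n the
    matrix of the conditions v(f) >= n d + 1 has independent rows. Independence
    is an open condition: it persists wherever a suitable polynomial in the jet
    does not vanish ([row_free_open]), and these polynomials, one for every d,
    define the countable union that a very general xi avoids. *)

(** * Power series and divisibility by powers of x *)

Section FpsOfPoly.
Variable K : comNzRingType.

Definition fps_of_poly (p : {poly K}) : fps K := Fps (fun i => p`_i).

Fact fps_of_poly_is_zmod_morphism : zmod_morphism fps_of_poly.
Proof. by move=> p q; apply/fpsP => i /=; rewrite coefB. Qed.

Fact fps_of_poly_is_monoid_morphism : monoid_morphism fps_of_poly.
Proof.
split=> [|p q]; apply/fpsP => i /=; first by rewrite coef1; case: eqP.
by rewrite coefM.
Qed.

HB.instance Definition _ := GRing.isZmodMorphism.Build {poly K} (fps K)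
  fps_of_poly fps_of_poly_is_zmod_morphism.
HB.instance Definition _ := GRing.isMonoidMorphism.Build {poly K} (fps K)
  fps_of_poly fps_of_poly_is_monoid_morphism.

Lemma fps_of_polyX : fps_of_poly 'X = fpsX K.
Proof. by apply/fpsP => i /=; rewrite coefX. Qed.

Lemma fps_of_polyC c : fps_of_poly c%:P = fpsC c.
Proof. by apply/fpsP => i /=; rewrite coefC. Qed.

Lemma fcoef_Xn (a : fps K) m i :
  fcoef (fpsX K ^+ m * a) i = if (i < m)%N then 0 else fcoef a (i - m).
Proof.
rewrite -fps_of_polyX -rmorphXn /=.
case: ltnP => [lt_im | le_mi].
  rewrite big1 // => k _.
  rewrite coefXn (_ : (k == m :> nat) = false) ?mul0r //.
  by apply/eqP => km; have := ltn_ord k; rewrite km ltnS leqNgt lt_im.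
rewrite (bigD1 (Ordinal (le_mi : (m < i.+1)%N))) //= coefXn eqxx mul1r.
rewrite big1 ?addr0 // => k ne_km; rewrite coefXn -val_eqE /= in ne_km *.
by rewrite (negbTE ne_km) mul0r.
Qed.

(** The substitution X |-> c X turns the weighted condition i + T j >= m into
    divisibility of every coefficient by x^m, with c = x^T. *)
Lemma coef_comp_scaleX (A : comNzRingType) (p : {poly A}) (c : A) j :
  (p \Po (c%:P * 'X))`_j = p`_j * c ^+ j.
Proof.
rewrite comp_polyE coef_sum.
have sum_j (i : 'I_(size p)) : (p`_i *: (c%:P * 'X) ^+ i)`_j =
    if i == j :> nat then p`_j * c ^+ j else 0.
  rewrite exprMn -polyC_exp mul_polyC !coefZ coefXn.
  by rewrite eq_sym; case: eqP => [->|_]; rewrite ?mulr1 // !mulr0.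
rewrite (eq_bigr _ (fun i _ => sum_j i)) -big_mkcond /=.
case: (ltnP j (size p)) => [lt_j | le_j].
  by rewrite (big_pred1 (Ordinal lt_j)).
rewrite big_pred0 => [|i]; first by rewrite nth_default // mul0r.
by apply/eqP => ij; have := ltn_ord i; rewrite ij ltnNge le_j.
Qed.

Definition xdvd m (q : {poly fps K}) :=
  forall i j, (i < m)%N -> fcoef q`_j i = 0.

Lemma xdvdP m q :
  xdvd m q <-> exists q', q = (fpsX K ^+ m)%:P * q'.
Proof.
split=> [q0 | [q' ->] i j lt_im]; last by rewrite coefCM fcoef_Xn lt_im.
exists (\poly_(j < size q) Fps (fun i => fcoef q`_j (m + i)%N)).
apply/polyP => j; rewrite coefCM coef_poly; apply/fpsP => i.
case: (ltnP j (size q)) => [lt_j | le_j]; last first.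
  by rewrite mulr0 nth_default.
by rewrite fcoef_Xn; case: ltnP => [/q0 -> // | le_mi]; rewrite /= subnKC.
Qed.

Lemma xdvd_comp m q r : xdvd m q -> xdvd m (q \Po r).
Proof.
move=> /xdvdP[q' ->]; apply/xdvdP; exists (q' \Po r).
by rewrite comp_polyM comp_polyC.
Qed.

(** The shift has an inverse of the same form. *)
Lemma xdvd_shift m q h : xdvd m (q \Po ('X + h%:P)) <-> xdvd m q.
Proof.
split=> [dvd_q | ]; last exact: xdvd_comp.
suff -> : q = (q \Po ('X + h%:P)) \Po ('X - h%:P) by apply: xdvd_comp.
by rewrite -comp_polyA comp_polyD comp_polyX comp_polyC subrK comp_polyXr.
Qed.

End FpsOfPoly.

(** * The pullback by (x, x^T X + P(x)) *)

Lemma rmorph_mmap (k : nat) (A : nzRingType) (B B' : comNzRingType)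
    (phi : {rmorphism B -> B'}) (g : A -> B) (h : 'I_k -> B) p :
  phi (mmap g h p) = mmap (phi \o g) (phi \o h) p.
Proof.
rewrite /mmap rmorph_sum; apply: eq_bigr => m _ /=; rewrite rmorphM; congr *%R.
by rewrite /mmap1 rmorph_prod; apply: eq_bigr => i _ /=; rewrite rmorphXn.
Qed.

Lemma eq_mmap (k : nat) (A : nzRingType) (B : nzRingType)
    (g g' : A -> B) (h h' : 'I_k -> B) p :
  g =1 g' -> h =1 h' -> mmap g h p = mmap g' h' p.
Proof. by move=> /funext -> /funext ->. Qed.

Section Pullback.
Variables (K : comNzRingType) (T : nat).
Implicit Types (P : {poly K}) (f : {mpoly K[2]}).

Definition coords P (k : 'I_2) : {poly {poly K}} :=
  if k == ord0 then 'X%:P else ('X^T)%:P * 'X + P%:P.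

Definition pullback P f : {poly {poly K}} :=
  mmap (polyC \o polyC) (coords P) f.

HB.instance Definition _ P := GRing.RMorphism.copy (pullback P)
  (mmap (polyC \o polyC) (coords P)).

End Pullback.

(** The pullback factors through (x, X + P(x)) followed by X |-> x^T X. *)
Lemma pullback_support (K : comNzRingType) T (P : {poly K}) f s j :
  (s < T * j)%N -> (pullback T P f)`_j`_s = 0.
Proof.
move=> lt_s.
have -> : pullback T P f = pullback 0 P f \Po (('X^T)%:P * 'X).
  rewrite [RHS]rmorph_mmap; apply: eq_mmap => [c | k] /=.
    by rewrite comp_polyC.
  rewrite /coords; case: ifP => _; first by rewrite comp_polyC.
  by rewrite comp_polyD comp_polyM !comp_polyC comp_polyX mul1r.
by rewrite coef_comp_scaleX -exprM coefMXn lt_s.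
Qed.

Section Bridge.
Variable R : realType.
Local Notation C := R[i].

(** Here x^T h is the part of xi beyond x^T, so y = xi + x^T X is also the
    truncation of xi plus x^T (X + h). *)
Lemma expansion_pullback T (xi : fps C) f :
  exists h : fps C, expansion xi f \Po ((fpsX C ^+ T)%:P * 'X) =
  map_poly (@fps_of_poly C) (pullback T (fps_trunc T xi) f) \Po ('X + h%:P).
Proof.
pose h : fps C := Fps (fun i => if i == 0%N then 0 else fcoef xi (T + i)).
exists h; rewrite [LHS]rmorph_mmap [X in X \Po _]rmorph_mmap [RHS]rmorph_mmap.
apply: eq_mmap => [c | k] /=.
  by rewrite map_polyC !comp_polyC /= fps_of_polyC.
rewrite /coords; case: ifP => _.
  by rewrite map_polyC !comp_polyC /= fps_of_polyX.
rewrite [map_poly _ _]rmorphD /= [map_poly _ _]rmorphM /=.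
rewrite !map_polyC map_polyX /=.
rewrite !(comp_polyD, comp_polyM, comp_polyC, comp_polyX) /=.
rewrite [fps_of_poly ('X^T)]rmorphXn /= fps_of_polyX mulrDr.
rewrite -addrA -polyCM -polyCD; congr (_ + _%:P).
apply/fpsP => i; rewrite -[RHS]/(fcoef (_ * h) i + (fps_trunc T xi)`_i).
rewrite fcoef_Xn coef_poly ltnS.
case: (ltngtP i T) => [lt_iT | lt_Ti | ->]; rewrite ?add0r //.
- rewrite /= subn_eq0 leqNgt lt_Ti /= subnKC ?addr0 ?(ltnW lt_Ti) //.
- by rewrite /= subnn add0r.
Qed.

(** This replaces the power series xi by its truncation at order T, and the
    weight i + T j by the order in x. *)
Lemma qmval_geP T (xi : fps C) f m :
  ((m%:R : R)%:E <= qmval xi T%:R f)%E <->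
  forall i j, (i < m)%N -> (pullback T (fps_trunc T xi) f)`_j`_i = 0.
Proof.
have [h e_h] := expansion_pullback T xi f.
suff vE : ((m%:R : R)%:E <= qmval xi T%:R f)%E <->
    xdvd m (expansion xi f \Po ((fpsX C ^+ T)%:P * 'X)).
  rewrite vE e_h xdvd_shift; split=> + i j lt_im => /(_ i j lt_im);
  by rewrite coef_map.
split=> [le_m i j lt_im | dvd_m].
  rewrite coef_comp_scaleX -exprM mulrC fcoef_Xn; case: ltnP => // le_i.
  apply/eqP/negPn/negP => nz.
  have : (qmval xi T%:R f <= ((i - T * j)%:R + T%:R * j%:R)%:E)%E.
    by apply: ereal_inf_lbound; exists ((i - T * j)%N, j).
  move=> /(le_trans le_m); rewrite lee_fin -natrM -natrD ler_nat subnK //.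
  by rewrite leqNgt lt_im.
apply/ereal_infP => _ [[i j] /= nz <-].
rewrite lee_fin -natrM -natrD ler_nat leqNgt; apply/negP => lt_m.
have := dvd_m (i + T * j)%N j lt_m.
rewrite coef_comp_scaleX -exprM mulrC fcoef_Xn ltnNge leq_addl /= addnK.
by move=> e; rewrite e eqxx in nz.
Qed.

End Bridge.

Lemma big_I2 (V : Type) (idx : V) (op : Monoid.law idx) (F : 'I_2 -> V) :
  \big[op/idx]_(i < 2) F i = op (F ord0) (F ord_max).
Proof.
rewrite big_ord_recl big_ord1; congr (op _ (F _)).
exact: val_inj.
Qed.

Section PullbackCoords.
Variables (K : comNzRingType) (T : nat) (P : {poly K}).

Lemma pullbackZ c f : pullback T P (c *: f) = c%:P%:P * pullback T P f.
Proof. exact: mmapZ. Qed.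

Lemma pullbackB f g :
  pullback T P (f - g) = pullback T P f - pullback T P g.
Proof. exact: mmapB. Qed.

Lemma pullbackXn f i : pullback T P (f ^+ i) = pullback T P f ^+ i.
Proof. exact: rmorphXn. Qed.

Lemma pullback_x : pullback T P 'X_ord0 = 'X%:P.
Proof. by rewrite [LHS]mmapX mmap1U. Qed.

Lemma pullback_y : pullback T P 'X_ord_max = ('X^T)%:P * 'X + P%:P.
Proof. by rewrite [LHS]mmapX mmap1U. Qed.

Lemma pullback_mon m :
  pullback T P 'X_[m] = ('X^(m ord0))%:P * (('X^T)%:P * 'X + P%:P) ^+ m ord_max.
Proof.
by rewrite [LHS]mmapX /mmap1 big_I2 polyC_exp.
Qed.

End PullbackCoords.

(** * The curve y = x^n *)

Section CurveEquation.
Variables (K : comNzRingType) (n : nat).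

Definition curve : {mpoly K[2]} := 'X_ord_max - 'X_ord0 ^+ n.

Lemma msize_curve : (n < msize curve)%N.
Proof.
have : (U_(ord0) *+ n)%MM \in msupp curve.
  have /negPf ne : U_(ord_max)%MM != (U_(ord0) *+ n)%MM :> 'X_{1..2}.
    apply/eqP => /(congr1 (fun m : 'X_{1..2} => m ord_max)).
    by rewrite mulmnE !mnm1E eqxx mul0n.
  rewrite mcoeff_msupp mcoeffB mpolyXn !mcoeffX eqxx ne sub0r.
  by rewrite oppr_eq0 oner_eq0.
by move/msize_mdeg_lt; rewrite mdegMn mdeg1 mul1n.
Qed.

Lemma pullback_curve T : pullback T 'X^n curve = ('X^T)%:P * 'X.
Proof.
rewrite pullbackB pullbackXn.
by rewrite pullback_x pullback_y -polyC_exp addrK.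
Qed.

End CurveEquation.

Section MonomialCurve.
Variables (K : idomainType) (n : nat).
Implicit Types f g : {mpoly K[2]}.

Local Notation curve := (curve K n).

Lemma curve_neq0 : curve != 0.
Proof. by rewrite -msize_poly_eq0 -lt0n (leq_trans _ (msize_curve K n)). Qed.

Definition restrict f : {poly K} :=
  mmap polyC (fun k => if k == ord0 then 'X else 'X^n) f.

Lemma restrict_pullback T f : (pullback T 'X^n f)`_0 = restrict f.
Proof.
rewrite -horner_coef0 -[LHS]/(horner_eval 0 _) [LHS]rmorph_mmap.
apply: eq_mmap => [c | k] /=; rewrite /horner_eval /coords ?hornerC //.
by case: ifP => _; rewrite !hornerE // mulr0 add0r.
Qed.

Lemma size_restrict d f :
  (0 < n)%N -> (msize f <= d.+1)%N -> (size (restrict f) <= (n * d).+1)%N.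
Proof.
move=> n_gt0 le_fd; apply: leq_trans (size_sum _ _ _) _.
apply/bigmax_leqP_seq => m /msize_mdeg_lt lt_m _.
rewrite mul_polyC /mmap1 big_I2 /= -exprM -exprD.
apply: leq_trans (size_scale_leq _ _) _; rewrite size_polyXn ltnS.
have := leq_trans lt_m le_fd; rewrite ltnS mdegE big_I2 /= => le_d.
rewrite (leq_trans _ (leq_mul (leqnn n) le_d)) // mulnDr leq_add2r.
by rewrite leq_pmull.
Qed.

(** Modulo y - x^n every polynomial is congruent to f (x, x^n), seen as a
    polynomial in x alone; on a monomial this is the factorization of
    y^b - (x^n)^b. *)
Lemma curve_factor f : restrict f = 0 -> exists g, f = curve * g.
Proof.
pose rho f := mmap (@mpolyC 2 K) (fun k => if k == ord0 then 'X_ord0 else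
  'X_ord0 ^+ n) f.
have rhoE h : rho h = (map_poly (@mpolyC 2 K) (restrict h)).['X_ord0].
  rewrite -[RHS]/((horner_eval _ \o map_poly (@mpolyC 2 K)) (restrict h)).
  rewrite [RHS]rmorph_mmap; apply: eq_mmap => [c | k] /=.
    by rewrite map_polyC /horner_eval hornerC.
  rewrite /horner_eval.
  by case: ifP => _; rewrite ?rmorphXn /= map_polyX !hornerE.
suff [g fE] : exists g, f - rho f = curve * g.
  by move=> f0; exists g; rewrite -fE rhoE f0 rmorph0 horner0 subr0.
elim/mpolyind: f => [|c m p _ _ [g gE]].
  by exists 0; rewrite /rho mmap0 subr0 mulr0.
exists (c *: ('X_ord0 ^+ m ord0 * \sum_(i < m ord_max)
  'X_ord_max ^+ ((m ord_max).-1 - i) * ('X_ord0 ^+ n) ^+ i) + g).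
rewrite mulrDr -gE /rho mmapD opprD addrACA; congr (_ + _).
rewrite mmapZ mmapX mul_mpolyC -scalerBr -scalerAr; congr (_ *: _).
by rewrite mpolyXE_id /mmap1 !big_I2 /= -mulrBr subrXX mulrCA.
Qed.

(** Bezout for the branch y = x^n: no nonzero polynomial of degree at most d
    has value above n d. Splitting off the curve lowers the degree bound by n, hence the
    bound on the value by n^2, which is exactly the value of the curve. *)
Lemma curve_pullback_bound d f :
  (0 < n)%N -> f != 0 -> (msize f <= d.+1)%N ->
  exists s j, (s <= n * d)%N /\ (pullback (n ^ 2) 'X^n f)`_j`_s != 0.
Proof.
move=> n_gt0; elim/ltn_ind: d f => d IHd f nz_f le_fd.
have [r0 | nz_r] := eqVneq (restrict f) 0; last first.
  (* The leading term of f (x, x^n) is a nonzero coefficient of X^0. *)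
  exists (size (restrict f)).-1, 0%N; rewrite restrict_pullback.
  rewrite -lead_coefE lead_coef_eq0 nz_r -ltnS prednK ?size_restrict //.
  by rewrite lt0n size_poly_eq0.
have [g fE] := curve_factor r0.
have nz_g : g != 0 by apply: contra_neq nz_f => g0; rewrite fE g0 mulr0.
have g_gt0 : (0 < msize g)%N by rewrite lt0n msize_poly_eq0.
have le_ng : (n + msize g <= d.+1)%N.
  apply: leq_trans le_fd; rewrite fE msizeM ?curve_neq0 //.
  by rewrite -ltnS prednK ?ltn_add2r ?msize_curve // addn_gt0 g_gt0 orbT.
have le_nd : (n <= d)%N.
  by rewrite -ltnS (leq_trans _ le_ng) // -addn1 leq_add2l.
have [||s [j [le_s nz_s]]] := IHd (d - n)%N _ g nz_g.
- by rewrite ltn_subrL n_gt0 (leq_trans n_gt0).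
- by rewrite -subSn // leq_subRL ?(leqW le_nd).
exists (s + n ^ 2)%N, j.+1; split.
  rewrite -(subnK (leq_mul (leqnn n) le_nd)) -mulnBr -mulnn.
  by rewrite leq_add2r.
rewrite fE rmorphM /= pullback_curve -mulrA coefCM mulrC coefXM /=.
by rewrite coefMXn ltnNge leq_addl /= addnK.
Qed.

End MonomialCurve.

(** * The linear conditions imposed by a value *)

(** The pairs (s, j) stand for the monomials x^s X^j with s < m that can occur
    in a pullback; for T > 0 the bound j < m follows from T j <= s < m. *)
Definition ladder T m : {set 'I_m * 'I_m} :=
  [set sj : 'I_m * 'I_m | (T * sj.2 <= sj.1)%N].

Lemma card_ladder T m :
  (0 < T)%N -> #|ladder T m| = (\sum_(s < m) (s %/ T).+1)%N.
Proof.
move=> T_gt0; rewrite -sum1_card (eq_bigl (fun sj : 'I_m * 'I_m =>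
  true && (T * sj.2 <= sj.1)%N)) => [|sj]; last by rewrite inE.
rewrite -(pair_big_dep xpredT (fun s j : 'I_m => (T * j <= s)%N)
  (fun _ _ => 1%N)) /=.
apply: eq_bigr => s _.
have le_m : ((s %/ T).+1 <= m)%N by rewrite (leq_ltn_trans (leq_div _ _)).
rewrite (eq_bigl (fun j : 'I_m => (j < (s %/ T).+1)%N)) => [|j]; last first.
  by rewrite ltnS leq_divRL // mulnC.
by rewrite (big_ord_narrow le_m) sum1_card card_ord.
Qed.

(** The next two bounds sum s - T < T (s %/ T) <= s over s < m. *)
Lemma card_ladder_ge T m : (0 < T)%N -> (m ^ 2 <= 2 * T * #|ladder T m|)%N.
Proof.
move=> T_gt0; rewrite card_ladder //; elim: m => [|m IHm]; first by [].
rewrite big_ord_recr /= mulnDr.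
have := ltn_ceil m T_gt0; rewrite -/(_ %/ _)%N; move: (m %/ T)%N => q lt_m.
move: IHm; set S := (\sum_(_ < _) _)%N; nia.
Qed.

Lemma card_ladder_le T m :
  (0 < T)%N -> (2 * T * #|ladder T m| <= m ^ 2 + 2 * T * m)%N.
Proof.
move=> T_gt0; rewrite card_ladder //; elim: m => [|m IHm].
  by rewrite big_ord0 !muln0.
rewrite big_ord_recr /= mulnDr.
have := leq_divM m T; move: (m %/ T)%N => q le_m.
move: IHm; set S := (\sum_(_ < _) _)%N; nia.
Qed.

(** For T = 1 the ladder indexes the monomials x^(s - j) y^j of degree at most
    d, so both sides of the dimension count are cardinals of ladders. *)
Lemma card_bmnm_ge d : (#|ladder 1 d.+1| <= #|{: 'X_{1..2 < d.+1}}|)%N.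
Proof.
pose mon (sj : 'I_d.+1 * 'I_d.+1) : 'X_{1..2} :=
  (U_(ord0) *+ (sj.1 - sj.2) + U_(ord_max) *+ sj.2)%MM.
have mdeg_mon sj : sj \in ladder 1 d.+1 -> (mdeg (mon sj) < d.+1)%N.
  rewrite inE mul1n => le_js.
  by rewrite mdegD !mdegMn !mdeg1 !mul1n subnK.
pose F sj : 'X_{1..2 < d.+1} := insubd (@bm0 2 d) (mon sj).
have F_inj : {in ladder 1 d.+1 &, injective F}.
  move=> [s j] [s' j'] in_l in_l' /(congr1 (@bmnm 2 d.+1)).
  rewrite /F !val_insubd !mdeg_mon // => /mnmP eq_m.
  move: (eq_m ord0) (eq_m ord_max) in_l in_l'.
  rewrite !mnmDE !mulmnE !mnm1E !inE /= !mul1n !mul0n !addn0 !add0n.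
  move=> eq_s eq_j le_j le_j'; congr pair; apply: val_inj => //=.
  by rewrite -(subnK le_j) eq_s eq_j subnK.
by rewrite -(card_in_imset F_inj) max_card.
Qed.

Section Conditions.
Variables (K : comNzRingType) (T m k : nat) (P : {poly K}).
Implicit Types e : 'I_k -> {mpoly K[2]}.

Definition cell (c : 'I_#|ladder T m|) : 'I_m * 'I_m := enum_val c.

(** Row r lists the coefficients that must vanish for e r to have value at
    least m. *)
Definition cond_mx e : 'M[K]_(k, #|ladder T m|) :=
  \matrix_(r, c) ((pullback T P (e r))`_(cell c).2)`_(cell c).1.

Lemma cond_mx_ker e (u : 'rV_k) : (0 < T)%N ->
  u *m cond_mx e = 0 <-> forall s j, (s < m)%N ->
    (pullback T P (\sum_(r < k) u 0 r *: e r))`_j`_s = 0.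
Proof.
move=> T_gt0.
have coefE s j : (pullback T P (\sum_(r < k) u 0 r *: e r))`_j`_s =
    \sum_(r < k) u 0 r * (pullback T P (e r))`_j`_s.
  rewrite rmorph_sum /= !coef_sum; apply: eq_bigr => r _.
  by rewrite pullbackZ !coefCM.
split=> [u0 s j lt_sm | u0]; last first.
  apply/rowP => c; rewrite !mxE -[RHS](u0 (cell c).1 (cell c).2) //.
  by rewrite coefE; apply: eq_bigr => r _; rewrite mxE.
case: (ltnP s (T * j)) => [/pullback_support -> // | le_s].
have lt_jm : (j < m)%N.
  by rewrite (leq_ltn_trans _ lt_sm) // (leq_trans _ le_s) // leq_pmull.
have in_l : (Ordinal lt_sm, Ordinal lt_jm) \in ladder T m by rewrite inE.
have /rowP/(_ (enum_rank_in in_l (Ordinal lt_sm, Ordinal lt_jm))) := u0.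
rewrite !mxE coefE => eq0; rewrite -[RHS]eq0; apply: eq_bigr => r _.
by rewrite mxE /cell enum_rankK_in.
Qed.

End Conditions.

Arguments cond_mx_ker {K T m k P e u}.

(** * Semicontinuity in the jet *)

Section JetPolynomial.
Variables (K : comNzRingType) (T : nat).

Definition jet_poly (a : 'I_T -> K) : {poly K} := \sum_(k < T) a k *: 'X^(k.+1).

Lemma jet_poly_mono n : (0 < n)%N -> (n <= T)%N ->
  jet_poly (fun k => (k.+1 == n)%:R) = 'X^n.
Proof.
case: n => // n _ lt_nT.
rewrite /jet_poly (bigD1 (Ordinal lt_nT)) //= eqxx scale1r big1 ?addr0 //.
by move=> k; rewrite -val_eqE eqSS /= => /negPf->; rewrite scale0r.
Qed.

End JetPolynomial.

Lemma map_jet_poly (K K' : comNzRingType) (phi : {rmorphism K -> K'}) T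
    (a : 'I_T -> K) :
  map_poly phi (jet_poly a) = jet_poly (phi \o a).
Proof.
rewrite rmorph_sum; apply: eq_bigr => k _ /=.
by rewrite map_polyZ map_polyXn.
Qed.

Lemma fps_trunc_jet (R : realType) T (xi : fps R[i]) :
  fcoef xi 0 = 0 -> fps_trunc T xi = jet_poly (jet (n := T) xi).
Proof.
move=> xi0; rewrite /fps_trunc poly_def big_ord_recl /= xi0 scale0r add0r.
by [].
Qed.

Section Semicontinuity.
Variables (F : fieldType) (T m k : nat) (mon : 'I_k -> 'X_{1..2}).

Let cond (K : comNzRingType) (P : {poly K}) :=
  cond_mx T m P (fun r => 'X_[mon r]).

Lemma cond_mx_map (K K' : comNzRingType) (phi : {rmorphism K -> K'}) P :
  map_mx phi (cond P) = cond (map_poly phi P).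
Proof.
apply/matrixP => r c; rewrite !mxE.
suff -> : pullback T (map_poly phi P) 'X_[mon r] =
    map_poly (map_poly phi) (pullback T P 'X_[mon r]) by rewrite !coef_map.
have morph (psi : {rmorphism {poly {poly K}} -> {poly {poly K'}}}) x y z t b :
    psi (x * (y * z + t) ^+ b) = psi x * (psi y * psi z + psi t) ^+ b.
  by rewrite rmorphM rmorphXn rmorphD rmorphM.
rewrite !pullback_mon morph /= !map_polyC map_polyX /=.
by rewrite !map_polyXn.
Qed.

(** If B is a right inverse of the matrix at a0, then p(a) is the determinant of
    the matrix at a times the constant matrix B: it is 1 at a0, and where it
    does not vanish the matrix at a still has a right inverse. That p is a
    polynomial is seen by taking the indeterminates themselves as jet. *)
Lemma row_free_open (a0 : 'I_T -> F) : row_free (cond (jet_poly a0)) ->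
  exists p : {mpoly F[T]}, p.@[a0] != 0 /\
    forall a, p.@[a] != 0 -> row_free (cond (jet_poly a)).
Proof.
move=> /row_freeP[B AB1].
pose G := cond (jet_poly (fun k : 'I_T => 'X_k : {mpoly F[T]})).
pose p := \det (G *m map_mx (@mpolyC T F) B).
have pE a : p.@[a] = \det (cond (jet_poly a) *m B).
  pose ev : {rmorphism {mpoly F[T]} -> F} := meval a.
  have evB : map_mx ev (map_mx (@mpolyC T F) B) = B.
    by apply/matrixP => i j; rewrite !mxE [LHS]mevalC.
  have ev_jet : map_poly ev (jet_poly (fun k : 'I_T => 'X_k)) = jet_poly a.
    rewrite map_jet_poly; congr jet_poly; apply/funext => i.
    exact: mevalXU.
  rewrite -[LHS]/(ev p) -(det_map_mx ev) (map_mxM ev) (cond_mx_map ev).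
  by rewrite evB ev_jet.
exists p; split=> [|a]; first by rewrite pE AB1 det1 oner_eq0.
rewrite pE => nz_det; apply/row_freeP.
exists (B *m invmx (cond (jet_poly a) *m B)).
by rewrite mulmxA mulmxV // unitmxE unitfE.
Qed.

End Semicontinuity.

(** * Codimension of the valuation ideals and bounds for mu *)

Lemma exists_ker (F : fieldType) k N (A : 'M[F]_(k, N)) :
  (N < k)%N -> exists2 u : 'rV_k, u != 0 & u *m A = 0.
Proof.
move=> lt_Nk.
have : kermx A != 0.
  rewrite -mxrank_eq0 mxrank_ker -lt0n subn_gt0.
  exact: leq_ltn_trans (rank_leq_col A) lt_Nk.
by case/rowV0Pn => u /sub_kermxP uA u0; exists u.
Qed.

Section Dual.
Variables (K : comNzRingType) (T m : nat) (P : {poly K}).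

Definition poly_in_x : {mpoly K[2]} := \sum_(i < size P) P`_i *: 'X_ord0 ^+ i.

Lemma pullback_poly_in_x : pullback T P poly_in_x = P%:P.
Proof.
rewrite -[in RHS](coefK P) poly_def rmorph_sum [in RHS]rmorph_sum /=.
apply: eq_bigr => i _; rewrite pullbackZ rmorphXn /= pullback_x -mul_polyC.
by rewrite polyCM polyC_exp.
Qed.

(** x^(s - T j) (y - P)^j pulls back to x^s X^j, so the linear conditions are
    the coordinate forms on this family. *)
Definition dual_family (c : 'I_#|ladder T m|) : {mpoly K[2]} :=
  let: (s, j) := cell c in
  'X_ord0 ^+ (s - T * j) * ('X_ord_max - poly_in_x) ^+ j.

Lemma cond_mx_dual : cond_mx T m P dual_family = 1%:M.
Proof.
have pull_dual c : pullback T P (dual_family c) =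
    ('X^((cell c).1))%:P * 'X^((cell c).2).
  have := enum_valP c; rewrite inE /dual_family -/(cell c).
  case: (cell c) => s j /= le_s; rewrite rmorphM !rmorphXn rmorphB /=.
  rewrite pullback_poly_in_x pullback_x pullback_y addrK exprMn mulrA.
  by rewrite -!polyC_exp -polyCM -exprM -exprD subnK.
apply/matrixP => r c; rewrite !mxE pull_dual coefCM coefXn.
have -> : (r == c) = (cell r == cell c) by rewrite (inj_eq enum_val_inj).
case: (cell r) (cell c) => [s j] [s' j'] /=; rewrite xpair_eqE -!val_eqE /=.
rewrite [in RHS](eq_sym (s : nat)) [in RHS](eq_sym (j : nat)).
by case: eqP => _; rewrite ?mulr1 ?mulr0 ?coef0 ?andbF // andbT coefXn.
Qed.

End Dual.

Section Degree.
Variables (F : fieldType) (d : nat).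

Definition mon_of (r : 'I_#|{: 'X_{1..2 < d.+1}}|) : 'X_{1..2} :=
  bmnm (enum_val r).

Lemma sum_mon_of (f : {mpoly F[2]}) : (msize f <= d.+1)%N ->
  f = \sum_r (\row_r f@_(mon_of r)) 0 r *: 'X_[mon_of r].
Proof.
move=> le_fd; rewrite {1}(mpolywE le_fd).
rewrite (big_enum_val (A := predT)
  (fun m : 'X_{1..2 < d.+1} => f@_m *: 'X_[m])).
by apply: eq_bigr => r _; rewrite mxE.
Qed.

Lemma mcoeff_sum_mon_of (u : 'rV[F]_#|{: 'X_{1..2 < d.+1}}|) r :
  (\sum_s u 0 s *: 'X_[mon_of s])@_(mon_of r) = u 0 r.
Proof.
rewrite raddf_sum /= (bigD1 r) //= mcoeffZ mcoeffX eqxx mulr1.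
rewrite big1 ?addr0 // => s ne_sr; rewrite mcoeffZ mcoeffX.
by rewrite (inj_eq val_inj) (inj_eq enum_val_inj) (negPf ne_sr) mulr0.
Qed.

Lemma msize_sum_mon_of (u : 'rV[F]_#|{: 'X_{1..2 < d.+1}}|) :
  (msize (\sum_s u 0 s *: 'X_[mon_of s]) <= d.+1)%N.
Proof.
apply: leq_trans (msize_sum _ _ _) _; apply/bigmax_leqP => s _.
by rewrite (leq_trans (msizeZ_le _ _)) // msizeX bmdeg.
Qed.

Lemma row_free_eq0 T m (P : {poly F}) f : (0 < T)%N ->
  row_free (cond_mx T m P (fun r => 'X_[mon_of r])) -> (msize f <= d.+1)%N ->
  (forall s j, (s < m)%N -> (pullback T P f)`_j`_s = 0) -> f = 0.
Proof.
move=> T_gt0 free le_fd; rewrite (sum_mon_of le_fd).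
set u := \row_r _ => /(cond_mx_ker T_gt0) uA0.
have -> : u = 0 by apply: (row_free_inj free); rewrite uA0 mul0mx.
by rewrite big1 // => r _; rewrite mxE scale0r.
Qed.

End Degree.

Section Values.
Variable R : realType.
Local Notation C := R[i].
Implicit Types xi : fps C.

(** Independence modulo the ideal is independence of the rows of conditions, so
    at most as many vectors as conditions; the dual family attains this. *)
Lemma codim_val_ideal T xi m : (0 < T)%N ->
  codim (val_ideal xi (T%:R : R) m) = (#|ladder T m|%:R)%:E.
Proof.
move=> T_gt0; apply/le_anti/andP; split.
  apply/ereal_supP => _ [k [e indep] <-]; rewrite lee_fin ler_nat leqNgt.
  apply/negP => /(exists_ker (cond_mx T m (fps_trunc T xi) e))[u nz_u].
  move=> /(cond_mx_ker T_gt0) u0; case/eqP: nz_u; apply/rowP => r.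
  rewrite mxE; apply: (indep (fun r => u 0 r)).
  by apply/qmval_geP => i j /u0.
apply: ereal_sup_ubound; exists #|ladder T m| => //.
exists (@dual_family C T m (fps_trunc T xi)) => c /qmval_geP c0 r.
pose u : 'rV[C]_#|ladder T m| := \row_r c r.
suff u0 : u = 0 by have /rowP/(_ r) := u0; rewrite !mxE.
rewrite -[u]mulmx1 -(cond_mx_dual T m (fps_trunc T xi)).
apply/(cond_mx_ker T_gt0) => s j lt_sm; rewrite -[RHS](c0 s j lt_sm).
by under eq_bigr => q _ do rewrite mxE.
Qed.

(** The values are integers, so a value not at least n d + 1 is at most n d. *)
Lemma mu_le n xi d : (0 < n)%N ->
  row_free (cond_mx (n ^ 2) (n * d).+1 (fps_trunc (n ^ 2) xi)
    (fun r => 'X_[mon_of (d := d) r])) ->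
  (mu xi ((n ^ 2)%:R : R) d <= ((n * d)%:R)%:E)%E.
Proof.
move=> n_gt0 free; apply/ereal_supP => _ [f [nz_f le_fd] <-].
have T_gt0 : (0 < n ^ 2)%N by rewrite expn_gt0 n_gt0.
have : ~ (((n * d).+1%:R : R)%:E <= qmval xi (n ^ 2)%:R f)%E.
  by move=> /qmval_geP f0; case/eqP: nz_f; apply: row_free_eq0 free le_fd f0.
move=> /negP; rewrite -ltNge => /ereal_inf_lt[_ [[i j] /= nz <-] lt_ij].
apply: ge_ereal_inf; exists (i%:R + (n ^ 2)%:R * j%:R)%:E.
  by exists (i, j).
by move: lt_ij; rewrite lte_fin lee_fin -natrM -natrD ltr_nat ler_nat.
Qed.

(** Dimension count: with m = n (d + 1) - n^2 one has (m + n^2)^2 =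
    n^2 (d + 1)^2 unless m = 0, so there are fewer conditions than monomials. *)
Lemma mu_ge n xi d : (0 < n)%N ->
  (((n * d.+1 - n ^ 2)%:R : R)%:E <= mu xi (n ^ 2)%:R d)%E.
Proof.
move=> n_gt0; set m := (n * d.+1 - n ^ 2)%N.
have T_gt0 : (0 < n ^ 2)%N by rewrite expn_gt0 n_gt0.
have lt_card : (#|ladder (n ^ 2) m| < #|{: 'X_{1..2 < d.+1}}|)%N.
  apply: leq_trans (card_bmnm_ge d).
  have := card_ladder_le m T_gt0; have := card_ladder_ge d.+1 (ltn0Sn 0).
  set L := #|ladder 1 _|; set N := #|ladder (n ^ 2) m|; move: L N => L N.
  rewrite /m; nia.
pose e r : {mpoly C[2]} := 'X_[mon_of (d := d) r].
have [u nz_u /(cond_mx_ker T_gt0) u0] :=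
  exists_ker (cond_mx (n ^ 2) m (fps_trunc (n ^ 2) xi) e) lt_card.
apply: le_ereal_sup_tmp; exists (qmval xi (n ^ 2)%:R (\sum_r u 0 r *: e r)).
  exists (\sum_r u 0 r *: e r) => //; split; last exact: msize_sum_mon_of.
  apply: contra_neq nz_u => f0; apply/rowP => r.
  by rewrite -mcoeff_sum_mon_of [X in X@__]f0 mcoeff0 mxE.
by apply/qmval_geP => s j; apply: u0.
Qed.

End Values.

(** * Passage to the limit *)

Section Limits.
Variable R : realType.
Local Open Scope classical_set_scope.

Lemma cvg_inv_nat : (fun d : nat => d%:R^-1 : R) @ \oo --> (0 : R).
Proof. by rewrite -cvg_shiftS; exact: cvg_harmonic. Qed.

Lemma cvg_mu_ratio n (xi : fps R[i]) : (0 < n)%N ->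
  (forall d, (mu xi ((n ^ 2)%:R : R) d <= ((n * d)%:R)%:E)%E) ->
  mu_ratio xi ((n ^ 2)%:R : R) @ \oo --> (n%:R : R)%:E.
Proof.
move=> n_gt0 le_mu.
apply: (@squeeze_cvge _ _ _ _
  (fun d => (n%:R - (n ^ 2)%:R * d%:R^-1)%:E) _ (fun=> (n%:R)%:E)).
- near=> d; have d_gt0 : (0 < d)%N by near: d; exact: nbhs_infty_gt.
  have nz_d : (d%:R : R) != 0 by rewrite pnatr_eq0 -lt0n.
  have inv_ge0 : (0 <= (d%:R^-1 : R)%:E)%E by rewrite lee_fin.
  rewrite /mu_ratio; apply/andP; split.
    apply: (le_trans _ (lee_wpmul2r inv_ge0 (mu_ge xi d n_gt0))).
    rewrite -EFinM lee_fin -[n%:R as X in X - _](mulfK nz_d) -mulrBl.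
    rewrite ler_wpM2r // lerBlDr -natrM -natrD ler_nat; lia.
  apply: (le_trans (lee_wpmul2r inv_ge0 (le_mu d))).
  by rewrite -EFinM lee_fin natrM mulfK.
- apply: cvg_EFin; first exact: nearW.
  rewrite /comp /= -[X in _ --> X]subr0 -[X in _ - X](mulr0 (n ^ 2)%:R).
  by apply: cvgB; [exact: cvg_cst | apply: cvgMr; exact: cvg_inv_nat].
- exact: cvg_cst.
Unshelve. all: by end_near. Qed.

Lemma vol_qm T (xi : fps R[i]) : (0 < T)%N -> vol xi (T%:R : R) = (T%:R^-1)%:E.
Proof.
move=> T_gt0; apply: cvg_lim => //.
rewrite (_ : (fun m => _) = fun m : nat =>
    (#|ladder T m|%:R * ((m%:R : R) ^+ 2 / 2%:R)^-1)%:E); last first.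
  by apply/funext => m; rewrite codim_val_ideal.
apply: cvg_EFin; first exact: nearW.
apply: (@squeeze_cvgr _ _ _ _ (fun=> T%:R^-1) (fun m => T%:R^-1 + 2 * m%:R^-1)).
- near=> m; have m_gt0 : (0 < m)%N by near: m; exact: nbhs_infty_gt.
  have mR_gt0 : 0 < (m%:R : R) by rewrite ltr0n.
  have TR_gt0 : 0 < (T%:R : R) by rewrite ltr0n.
  have := card_ladder_ge m T_gt0; have := card_ladder_le m T_gt0.
  rewrite -!mulnn -!(ler_nat R) natrD !natrM -!expr2 /=.
  move: (#|_|%:R) (T%:R) (m%:R) mR_gt0 TR_gt0 => N t x x_gt0 t_gt0 le_N ge_N.
  have -> : N * (x ^+ 2 / 2)^-1 = (2 * t * N) / (t * x ^+ 2).
    by field; rewrite !gt_eqF.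
  have tx_gt0 : 0 < t * x ^+ 2 by rewrite mulr_gt0 ?exprn_gt0.
  rewrite ler_pdivlMr // ler_pdivrMr //.
  have -> : t^-1 * (t * x ^+ 2) = x ^+ 2 by field; rewrite gt_eqF.
  have -> : (t^-1 + 2 * x^-1) * (t * x ^+ 2) = x ^+ 2 + 2 * t * x.
    by field; rewrite !gt_eqF.
  by apply/andP.
- exact: cvg_cst.
- rewrite -[X in _ --> X]addr0 -[X in _ + X](mulr0 2).
  by apply: cvgD; [exact: cvg_cst | apply: cvgMr; exact: cvg_inv_nat].
Unshelve. all: by end_near. Qed.

End Limits.

(** * Very general jets *)

Lemma exists_bound_poly (R : realType) n d : (0 < n)%N ->
  exists p : {mpoly R[i][n ^ 2]}, (exists a, p.@[a] != 0) /\
    forall xi : fps R[i], fcoef xi 0 = 0 -> p.@[jet (n := n ^ 2) xi] != 0 ->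
      (mu xi ((n ^ 2)%:R : R) d <= ((n * d)%:R)%:E)%E.
Proof.
move=> n_gt0; have T_gt0 : (0 < n ^ 2)%N by rewrite expn_gt0 n_gt0.
have le_nT : (n <= n ^ 2)%N by rewrite -mulnn leq_pmulr.
pose a0 (k : 'I_(n ^ 2)) : R[i] := (k.+1 == n)%:R.
have free0 : row_free (cond_mx (n ^ 2) (n * d).+1 (jet_poly a0)
    (fun r => 'X_[mon_of (d := d) r])).
  (* The jet a0 is that of x^n, where the bound on values is known. *)
  apply: inj_row_free => u /(cond_mx_ker T_gt0).
  rewrite jet_poly_mono // => u0.
  have [f0 | nz_f] := eqVneq (\sum_r u 0 r *: 'X_[mon_of (d := d) r]) 0.
    by apply/rowP => r; rewrite -mcoeff_sum_mon_of [X in X@__]f0 mcoeff0 mxE.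
  have [s [j [le_s]]] := curve_pullback_bound n_gt0 nz_f (msize_sum_mon_of u).
  by rewrite u0 ?eqxx.
have [p [nz_p free]] := row_free_open free0.
exists p; split=> [|xi xi0 nz_xi]; first by exists a0.
by apply: (mu_le n_gt0); rewrite (fps_trunc_jet _ xi0); exact: free nz_xi.
Qed.

Theorem proposition2p22 (R : realType) (t : R) (n : nat)
    (n_gt0 : (0 < n)%N) (t_sq : t = n%:R ^+ 2) :
  very_general (fun xi : fps R[i] =>
    [/\ cvgn (mu_ratio xi t), minimal xi t & mu_hat xi t = (Num.sqrt t)%:E]).
Proof.
have [p pP] := choice (fun d => exists_bound_poly R d n_gt0).
exists (n ^ 2)%N, (fun d => [set a | (p d).@[a] = 0])%classic.
split=> [d | xi xi0 gen].
  split; first by exists [set p d]%classic; apply/seteqP; split=> a /=;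
    [move=> pa0 q -> | apply].
  have [[a nz_a] _] := pP d => eqT.
  have : [set: 'I_(n ^ 2) -> R[i]]%classic a by [].
  by rewrite -eqT /= => pa0; rewrite pa0 eqxx in nz_a.
have le_mu d : (mu xi ((n ^ 2)%:R : R) d <= ((n * d)%:R)%:E)%E.
  have [_ bound] := pP d; apply: bound => //; apply/eqP => pa0.
  by apply: gen; exists d.
have T_gt0 : (0 < n ^ 2)%N by rewrite expn_gt0 n_gt0.
have cvg_mu := cvg_mu_ratio n_gt0 le_mu.
have hat_mu : mu_hat xi ((n ^ 2)%:R : R) = (n%:R)%:E by exact: cvg_lim.
have -> : t = (n ^ 2)%:R by rewrite natrX.
split; first exact: (cvgP _ cvg_mu).
  rewrite /minimal hat_mu vol_qm //= natrX -exprVn sqrtr_sqr.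
  by rewrite ger0_norm ?invrK // invr_ge0.
by rewrite hat_mu natrX sqrtr_sqr ger0_norm.
Qed.
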